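(* Let $X$ be a reflexive Banach space, let the set $Q$ be weakly sequentially closed, let the functions $f$ and $\varphi$ be weakly sequentially lower semicontinuous on $Q$, and let the problem $(\mathcal{P})$: minimize $f(x)$ subject to $x \in M$, $x \in Q$, be weakly Levitin-Polyak well-posed with respect to the infeasibility measure $\varphi$. Then the penalty function $F_c = f + c\varphi$ is globally exact if and only if the following two conditions hold true: 1. there exists $c_0 \ge 0$ such that the set $S_{c_0}(f_* ) := \{ x \in Q \mid F_{c_0}(x) < f_* \}$ is either bounded or empty; 2. $F_c$ is uniformly locally exact at globally optimal solutions of $(\mathcal{P})$, that is, $F_c$ is locally exact at every point $x_* \in \operatorname{argmin}(\mathcal{P})$ and there exist $0 < c_* < +\infty$ and $0 < r_* < +\infty$ such that $c_*(x_* ) < c_*$ and $r_*(x_*, c_* ) \ge r_*$ for any $x_* \in \operatorname{argmin}(\mathcal{P})$.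
   Context: $M,Q \subset X$ are nonempty, $f \colon X \to \mathbb{R}\cup\{+\infty\}$. The feasible region $\Omega = M \cap Q$ is nonempty and the optimal value $f_* = \inf_{x\in\Omega} f(x)$ is finite; $\operatorname{argmin}(\mathcal{P})$ is the set of globally optimal solutions of $(\mathcal{P})$. Notation: $\operatorname{dist}(x,V) = \inf_{y \in V} \|x-y\|$, $B(x,r) = \{y \in X \mid \|x-y\| \le r\}$. An infeasibility measure (penalty term) for the constraint $x \in M$ on $Q$ is a function $\varphi \colon X \to [0,+\infty]$ such that for any $x \in Q$ one has $\varphi(x)=0 \iff x \in M$; such a $\varphi$ is fixed, and $F_c(x) = f(x) + c\varphi(x)$, $x\in X$, $c \ge 0$. The penalized problem is: minimize $F_c(x)$ subject to $x \in Q$. $(\mathcal{P})$ is weakly Levitin-Polyak well-posed with respect to $\varphi$ if $\operatorname{argmin}(\mathcal{P}) \neq \emptyset$ and for any sequence $\{x_n\}\subset X$ such that $f(x_n)\to f_*$ and $\varphi(x_n)\to 0$ one has $\operatorname{dist}(x_n,\operatorname{argmin}(\mathcal{P}))\to 0$ (distance in norm). $F_c$ is globally exact if there exists $c_* \ge 0$ such that for any $c \ge c_*$ the sets of globally optimal solutions of $(\mathcal{P})$ and of the penalized problem coincide. $F_c$ is locally exact at a locally optimal solution $x_*$ of $(\mathcal{P})$ if there exists $c_* \ge 0$ such that for any $c\ge c_*$ the point $x_*$ is a locally optimal solution of the penalized problem; $c_*(x_* )$ denotes the infimum of all such $c_*$. For such a $c_*$, $r_*(x_*,c_* )$ (the radius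 of local exactness) is the supremum of all $r>0$ such that $F_c(x) \ge F_c(x_* )$ for all $x \in B(x_*,r)\cap Q$ and all $c \ge c_*$. *)

(* Defs.v *)
From HB Require Import structures.
From mathcomp Require Import all_boot all_order all_algebra.
From mathcomp Require Import all_classical all_reals all_analysis.

Set Implicit Arguments.
Unset Strict Implicit.
Unset Printing Implicit Defensive.

Import Order.TTheory GRing.Theory Num.Theory.
Import numFieldNormedType.Exports.

Local Open Scope classical_set_scope.
Local Open Scope ring_scope.

Section NormedSpaces.
Context {R : realType} {X : normedModType R}.

Definition dual : set (X -> R) := [set l : X -> R | scalar l /\ continuous l].

Definition dual_norm (l : X -> R) : R :=
  sup [set `|l x| | x in [set x : X | `|x| <= 1]].

(* Only the values of Phi on [dual] matter: every functional on the dual space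
   is the restriction to [dual] of some Phi : (X -> R) -> R. *)
Definition bidual : set ((X -> R) -> R) :=
  [set Phi |
    (forall (a : R) l1 l2, dual l1 -> dual l2 ->
       Phi (fun x => a * l1 x + l2 x) = a * Phi l1 + Phi l2) /\
    (exists C : R, forall l, dual l -> `|Phi l| <= C * dual_norm l)].

Definition weak_cvg (u : nat -> X) (x : X) : Prop :=
  forall l, dual l -> l (u n) @[n --> \oo] --> l x.

Definition weakly_seq_closed (A : set X) : Prop :=
  forall (u : nat -> X) (x : X), (forall n, A (u n)) -> weak_cvg u x -> A x.

Definition weakly_seq_lsc_on (A : set X) (g : X -> \bar R) : Prop :=
  forall (u : nat -> X) (x : X), (forall n, A (u n)) -> A x ->
    weak_cvg u x -> (g x <= limn_einf (fun n => g (u n)))%E.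

Definition dist (x : X) (V : set X) : R := inf [set `|x - y| | y in V].

Definition global_sol (A : set X) (g : X -> \bar R) : set X :=
  [set x | A x /\ forall y, A y -> (g x <= g y)%E].

Definition local_sol (A : set X) (g : X -> \bar R) : set X :=
  [set x | A x /\ \forall y \near x, A y -> (g x <= g y)%E].

Definition opt_value (A : set X) (g : X -> \bar R) : \bar R :=
  ereal_inf (g @` A).

End NormedSpaces.

Definition reflexive_space (R : realType) (X : normedModType R) : Prop :=
  forall Phi, @bidual R X Phi ->
    exists x : X, forall l, dual l -> Phi l = l x.

Section Penalty.
Context {R : realType} {X : normedModType R}.
Context (M Q : set X) (f phi : X -> \bar R).

Definition infeasibility_measure : Prop :=
  (forall x, (0 <= phi x)%E) /\ (forall x, Q x -> (phi x = 0%E <-> M x)).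

Definition argminP : set X := global_sol (M `&` Q) f.

(* For c = 0 this is f, even where phi is infinite: 0 * +oo = 0 in \bar R. *)
Definition penalty (c : R) (x : X) : \bar R := (f x + c%:E * phi x)%E.

Definition weakly_LP_well_posed : Prop :=
  argminP !=set0 /\
  forall u : nat -> X,
    f (u n) @[n --> \oo] --> opt_value (M `&` Q) f ->
    phi (u n) @[n --> \oo] --> 0%E ->
    dist (u n) argminP @[n --> \oo] --> (0 : R).

Definition globally_exact : Prop :=
  exists2 cs : R, 0 <= cs &
    forall c, cs <= c -> argminP = global_sol Q (penalty c).

Definition local_exactness_params (x : X) : set R :=
  [set cs | 0 <= cs /\ forall c, cs <= c -> local_sol Q (penalty c) x].

Definition locally_exact (x : X) : Prop := local_exactness_params x !=set0.

Definition least_exact_param (x : X) : \bar R :=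
  ereal_inf (EFin @` local_exactness_params x).

(* May be +oo; it is -oo when no radius qualifies. *)
Definition exactness_radius (x : X) (cs : R) : \bar R :=
  ereal_sup (EFin @` [set r : R | 0 < r /\
    forall y, (closed_ball_ Num.norm x r `&` Q) y ->
      forall c, cs <= c -> (penalty c x <= penalty c y)%E]).

Definition uniformly_locally_exact : Prop :=
  (forall x, argminP x -> locally_exact x) /\
  exists cs rs : R, [/\ 0 < cs, 0 < rs &
    forall x, argminP x ->
      (least_exact_param x < cs%:E)%E /\ (rs%:E <= exactness_radius x cs)%E].

Definition penalty_sublevel (c : R) : set X :=
  [set x | Q x /\ (penalty c x < opt_value (M `&` Q) f)%E].

End Penalty.

(* Main.v *)
Require Import Defs.
From HB Require Import structures.
From mathcomp Require Import all_boot all_order all_algebra.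
From mathcomp Require Import all_classical all_reals all_analysis.
From mathcomp Require Import lra.
Import Order.TTheory GRing.Theory Num.Theory.
Import numFieldNormedType.Exports.
Local Open Scope classical_set_scope.
Local Open Scope ring_scope.

(** If no parameter c made fstar a lower bound of F_c on Q, there would be points
x_n of Q with F_{c_n}(x_n) < fstar and c_n -> +oo.  They lie in
the bounded set S_{c_0}, and reflexivity gives a subsequence converging weakly to
some x in Q.  Lower semicontinuity of f bounds f(x_n) from below, which forces phi(x_n) -> 0,
so x is feasible and f(x_n) -> fstar.  Well-posedness brings x_n within the uniform
exactness radius of a minimizer, where F_{c_n} >= fstar: a contradiction.  Exactness
at c' > c follows from the bound at c, because a minimizer of F_{c'} must then have
phi = 0.

Weak sequential compactness rests on a Hahn-Banach theorem, obtained by observing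
that a minimal sublinear functional is linear. *)

(** * Sublinear functionals and the Hahn-Banach theorem *)

Section HahnBanach.
Set Implicit Arguments.
Unset Strict Implicit.
Context {R : realType} {X : lmodType R}.
Implicit Types (p q : X -> R) (x y z : X).

(* Positive homogeneity is only required as an inequality, which suffices. *)
Definition sublinear p : Prop :=
  (forall x y, p (x + y) <= p x + p y) /\
  (forall a x, 0 <= a -> p (a *: x) <= a * p x).

Lemma sublinear0 p : sublinear p -> p 0 = 0.
Proof.
move=> [pD pZ]; apply/eqP; rewrite eq_le; apply/andP; split.
  by have := pZ 0 0 (lexx _); rewrite scale0r mul0r.
by have := pD 0 0; rewrite addr0; lra.
Qed.

Lemma sublinear_oppr p x : sublinear p -> - p (- x) <= p x.
Proof.
move=> sp; have := sp.1 x (- x).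
by rewrite subrr (sublinear0 sp); lra.
Qed.

(** Applying the inequality with [a^-1] to [a *: x] reverses it. *)
Lemma sublinearZ p a x : sublinear p -> 0 <= a -> p (a *: x) = a * p x.
Proof.
move=> sp; rewrite le_eqVlt => /orP[/eqP<-|a0].
  by rewrite scale0r mul0r (sublinear0 sp).
apply/eqP; rewrite eq_le (sp.2 _ _ (ltW a0)) /=.
have ai : 0 <= a^-1 by rewrite invr_ge0 ltW.
have := sp.2 a^-1 (a *: x) ai.
by rewrite scalerA mulVf ?gt_eqF// scale1r ler_pdivlMl.
Qed.

(** A common criterion for three infima: over a chain in Zorn's lemma, along a direction, and for
    the distance to a rational span. The slack [e] serves the last one. *)
Lemma sublinear_inf (I : Type) (P : set I) (g : I -> X -> R) :
  P !=set0 ->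
  (forall x, has_lbound [set g i x | i in P]) ->
  (forall i j x y, P i -> P j ->
    exists2 k, P k & g k (x + y) <= g i x + g j y) ->
  (forall a e i x, 0 <= a -> 0 < e -> P i ->
    exists2 k, P k & g k (a *: x) <= a * g i x + e) ->
  sublinear (fun x => inf [set g i x | i in P]).
Proof.
move=> [i0 Pi0] glb gD gZ.
have ne x : [set g i x | i in P] !=set0 by exists (g i0 x), i0.
have infle i x : P i -> inf [set g i x | i in P] <= g i x.
  by move=> Pi; apply: ge_inf => //; exists i.
have leinf x b : (forall i, P i -> b <= g i x) ->
    b <= inf [set g i x | i in P].
  by move=> h; apply: lb_le_inf => // _ [i Pi <-]; exact: h.
split=> [x y|a x a0].
  rewrite -lerBlDr; apply: (leinf) => i Pi.
  rewrite lerBlDr -lerBlDl; apply: (leinf) => j Pj.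
  rewrite lerBlDl; have [k Pk] := gD i j x y Pi Pj.
  exact: le_trans (infle _ _ Pk).
move: a0; rewrite le_eqVlt => /orP[/eqP<-|a0].
  rewrite mul0r; apply/ler_addgt0Pl => e e0.
  have [k Pk] := gZ 0 e i0 x (lexx _) e0 Pi0.
  by rewrite mul0r add0r addr0; exact: le_trans (infle _ _ Pk).
rewrite -ler_pdivrMl//; apply: (leinf) => i Pi.
rewrite ler_pdivrMl//; apply/ler_addgt0Pr => e e0.
have [k Pk] := gZ a e i x (ltW a0) e0 Pi.
exact: le_trans (infle _ _ Pk).
Qed.

(** Zorn's lemma for the reversed pointwise order. The infimum of a chain is finite because every
    sublinear [q] below [p] satisfies [- p (- x) <= q x]. *)
Lemma exists_minimal_sublinear p : sublinear p ->
  exists q, [/\ sublinear q, forall x, q x <= p x &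
    forall q', sublinear q' -> (forall x, q' x <= q x) -> q' = q].
Proof.
move=> sp.
pose T := {q : X -> R | sublinear q /\ forall x, q x <= p x}.
pose mk q sq qp : T := exist _ q (conj sq qp).
pose r (q1 q2 : T) := `[< forall x, sval q2 x <= sval q1 x >].
have [||||[q [sq qp]] qmin] := @Zorn T r.
- by move=> t; apply/asboolP.
- move=> q1 q2 q3 /asboolP h /asboolP k; apply/asboolP => x.
  exact: le_trans (k x) (h x).
- move=> [q1 h1] [q2 h2] /asboolP /= h /asboolP /= k; apply: eq_exist => /=.
  by apply/funext => x; apply/eqP; rewrite eq_le h k.
- move=> A Atot; have [->|/set0P A0] := eqVneq A set0.
    by exists (mk p sp (fun x => lexx (p x))).
  pose g (q : T) := sval q.
  have lb x : has_lbound [set g q x | q in A].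
    exists (- p (- x)) => _ [[q [sq qp]] _ <-] /=.
    by rewrite (le_trans _ (sublinear_oppr _ sq))// lerN2.
  have infle (q : T) x : A q -> inf [set g q x | q in A] <= g q x.
    by move=> Aq; apply: ge_inf => //; exists q.
  have sinf : sublinear (fun x => inf [set g q x | q in A]).
    apply: sublinear_inf => //.
    + move=> q1 q2 x y A1 A2.
      have [/asboolP h|/asboolP h] := Atot _ _ A1 A2.
        exists q2 => //; apply: le_trans ((svalP q2).1.1 x y) _.
        by rewrite lerD2r; exact: h.
      exists q1 => //; apply: le_trans ((svalP q1).1.1 x y) _.
      by rewrite lerD2l; exact: h.
    + move=> a e q x a0 e0 Aq; exists q => //.
      by rewrite (le_trans ((svalP q).1.2 a x a0))// lerDl ltW.
  have infp x : inf [set g q x | q in A] <= p x.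
    have [q Aq] := A0.
    by apply: le_trans (infle _ _ Aq) _; case: (svalP q).
  exists (mk _ sinf infp) => q Aq.
  by apply/asboolP => x /=; exact: infle.
exists q; split => // q' sq' q'q.
have q'p x : q' x <= p x by exact: le_trans (q'q x) (qp x).
by have /(congr1 sval)/= := qmin (mk q' sq' q'p) (asboolT q'q).
Qed.

(* Lowering a sublinear functional in the direction z turns its value at - z
   into - p z, while keeping it sublinear. *)
Lemma sublinear_lower p z : sublinear p ->
  exists q, [/\ sublinear q, forall x, q x <= p x & q (- z) <= - p z].
Proof.
move=> sp; pose P := [set t : R | 0 <= t].
pose g (t : R) x := p (x + t *: z) - t * p z.
have lb x : has_lbound [set g t x | t in P].
  exists (- p (- x)) => _ [t t0 <-]; rewrite /g.
  have := sp.1 (- x) (x + t *: z).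
  by rewrite addKr (sublinearZ _ sp t0); lra.
have infle t x : 0 <= t -> inf [set g t x | t in P] <= g t x.
  by move=> t0; apply: ge_inf => //; exists t.
exists (fun x => inf [set g t x | t in P]); split.
- apply: sublinear_inf => //.
  + by exists 0; exact: lexx.
  + move=> t s x y t0 s0; exists (t + s); first exact: addr_ge0.
    rewrite /g scalerDl addrACA.
    by have := sp.1 (x + t *: z) (y + s *: z); lra.
  + move=> a e t x a0 e0 t0; exists (a * t); first exact: mulr_ge0.
    rewrite /g -scalerA -scalerDr mulrBr mulrA.
    by have := sp.2 a (x + t *: z) a0; lra.
- move=> x; apply: le_trans (infle 0 x (lexx _)) _.
  by rewrite /g scale0r addr0 mul0r subr0.
- apply: le_trans (infle 1 _ ler01) _.
  by rewrite /g scale1r addNr (sublinear0 sp) mul1r add0r.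
Qed.

(** Lowering [p] along [z] first forces any linear functional below the result to equal [p z] at
    [z]. A minimal sublinear functional cannot be lowered further, so it is odd, and oddness turns
    subadditivity into additivity. *)
Theorem hahn_banach p z : sublinear p ->
  exists l : X -> R, [/\ scalar l, forall x, l x <= p x & l z = p z].
Proof.
move=> sp; have [p' [sp' p'p p'z]] := sublinear_lower z sp.
have [l [sl lp' lmin]] := exists_minimal_sublinear sp'.
have lN x : l (- x) = - l x.
  have [q [sq ql qx]] := sublinear_lower x sl.
  have lq := lmin q sq ql; rewrite lq in qx.
  by have := sublinear_oppr x sl; lra.
have lD x y : l (x + y) = l x + l y.
  apply/eqP; rewrite eq_le sl.1 /=.
  by have := sl.1 (- x) (- y); rewrite -opprD !lN; lra.
have lp x : l x <= p x := le_trans (lp' x) (p'p x).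
exists l; split => //.
- move=> a x y; rewrite lD; congr (_ + _).
  have [a0|a0] := leP 0 a; first exact: sublinearZ.
  rewrite -[a]opprK scaleNr lN (sublinearZ _ sl) ?oppr_ge0 ?ltW//.
  by rewrite !mulNr.
- by have := lp z; have := le_trans (lp' (- z)) p'z; rewrite lN; lra.
Qed.

End HahnBanach.

(** * Convergence along ultrafilters *)

Section Ultrafilters.
Set Implicit Arguments.
Unset Strict Implicit.
Context {T : Type} {Y : topologicalType}.

Lemma compact_ultra_cvg (G : set_system T) (f : T -> Y) (K : set Y) :
  UltraFilter G -> compact K -> G (f @^-1` K) -> exists y : Y, f x @[x --> G] --> y.
Proof.
move=> GU cK GK; have [y [_ cly]] := cK (f x @[x --> G]) _ GK.
exists y => N yN; have [//|GN] := in_ultra_setVsetC (f @^-1` N) GU.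
have [z [nNz Nz]] := cly (~` N) N GN yN.
by case: nNz.
Qed.

(** If the preimage of a neighbourhood is not in [F], then [F] restricted to its complement is
    proper, and an ultrafilter refining it violates the hypothesis. *)
Lemma cvg_of_ultra (F : set_system T) (f : T -> Y) (y : Y) :
  ProperFilter F ->
  (forall G, UltraFilter G -> F `<=` G -> f x @[x --> G] --> y) ->
  f x @[x --> F] --> y.
Proof.
move=> FF h N yN; apply: contrapT => nFN.
have W : ProperFilter (within (~` (f @^-1` N)) F).
  split; last exact: within_filter.
  rewrite /within /= => w0; apply: nFN.
  change (F (f @^-1` N)); apply: filterS w0 => x nx.
  by apply: contrapT => /nx.
have [G [GU WG]] := ultraFilterLemma W.
have FG : F `<=` G.
  by move=> A FA; apply: WG; apply: filterS FA => x Ax _.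
have GN : G (f @^-1` N) by exact: h FG N yN.
have GnN : G (~` (f @^-1` N)) by apply: WG; exact: withinT.
by have [x []] := filter_ex (filterI GN GnN).
Qed.

End Ultrafilters.

(** * Continuous functionals and limits in a reflexive space *)

Section Dual.
Set Implicit Arguments.
Unset Strict Implicit.
Context {R : realType} {X : normedModType R}.
Implicit Types (l : X -> R) (x y : X).

Lemma scalar_funB l x y : scalar l -> l (x - y) = l x - l y.
Proof. by move=> sl; rewrite addrC -scaleN1r sl mulN1r addrC. Qed.

Lemma scalar_fun0 l : scalar l -> l 0 = 0.
Proof. by move=> sl; rewrite -(subrr 0) scalar_funB// subrr. Qed.

Lemma scalar_funZ l a x : scalar l -> l (a *: x) = a * l x.
Proof. by move=> sl; rewrite -[a *: x]addr0 sl (scalar_fun0 sl) addr0. Qed.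

Lemma scalar_funN l x : scalar l -> l (- x) = - l x.
Proof. by move=> sl; rewrite -sub0r scalar_funB// scalar_fun0// sub0r. Qed.

Lemma dual_of_le_norm l : scalar l -> (forall x, l x <= `|x|) -> dual l.
Proof.
move=> sl le; split => // x; apply/cvgrPdist_lt => e e0; near=> y.
rewrite -(scalar_funB _ _ sl).
have h : `|l (x - y)| <= `|x - y|.
  by rewrite ler_norml le andbT lerNl -(scalar_funN _ sl) -[leRHS]normrN le.
apply: le_lt_trans h _; near: y.
exact: (@cvgr_dist_lt _ X X (nbhs x) _ id x) => //.
Unshelve. all: by end_near. Qed.

Lemma dual_norm_has_ubound l : dual l ->
  has_ubound [set `|l x| | x in [set x : X | `|x| <= 1]].
Proof.
move=> [sl cl]; have := cl 0; rewrite /continuous_at (scalar_fun0 sl).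
move=> /cvgr_distC_lt/(_ 1 ltr01); rewrite nearE => /nbhs_ballP[d /= d0 h].
(* Scaling by [d / 2] moves the unit ball inside the ball of radius [d], where [l] is below 1 in
   absolute value. *)
exists (2 / d) => _ [x /= x1 <-].
have : `|l ((d / 2) *: x)| < 1.
  have := h ((d / 2) *: x); rewrite subr0; apply.
  rewrite -ball_normE /= sub0r normrN normrZ gtr0_norm ?divr_gt0//.
  apply: (@le_lt_trans _ _ (d / 2)); last by lra.
  by rewrite ler_piMr// divr_ge0// ltW.
rewrite (scalar_funZ _ _ sl) normrM gtr0_norm ?divr_gt0// => /ltW.
by rewrite -ler_pdivlMl ?divr_gt0// invf_div mulr1.
Qed.

Lemma dual_norm_ge0 l : dual l -> 0 <= dual_norm l.
Proof.
move=> dl; apply: (@le_trans _ _ `|l 0|); first exact: normr_ge0.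
apply: ub_le_sup; first exact: dual_norm_has_ubound.
by exists 0 => //=; rewrite normr0 ler01.
Qed.

Lemma dual_norm_le l x : dual l -> `|l x| <= dual_norm l * `|x|.
Proof.
move=> dl; have sl := dl.1.
have [->|x0] := eqVneq x 0; first by rewrite scalar_fun0// !normr0 mulr0.
have nx0 : 0 < `|x| by rewrite normr_gt0.
rewrite -ler_pdivrMr// mulrC -[X in X * _]gtr0_norm ?invr_gt0//.
rewrite -normrM -scalar_funZ//; apply: ub_le_sup; first exact: dual_norm_has_ubound.
exists (`|x|^-1 *: x) => //=.
by rewrite normrZ gtr0_norm ?invr_gt0// mulVf// gt_eqF.
Qed.

Lemma exists_norming_functional x :
  exists l, [/\ dual l, forall y, l y <= `|y| & l x = `|x|].
Proof.
have sn : sublinear (@Num.norm R X).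
  split=> [y z|a y a0]; first exact: ler_normD.
  by rewrite normrZ ger0_norm.
have [l [sl ln lx]] := hahn_banach x sn.
by exists l; split => //; exact: dual_of_le_norm.
Qed.

(** Each [l (u n)] stays in a compact segment, so it converges along [G]. The limit is linear in [l]
    and bounded by [C] times the dual norm; reflexivity represents it by a point. *)
Lemma reflexive_ultra_cvg (u : nat -> X) (C : R) (G : set_system nat) :
  reflexive_space X -> (forall n, `|u n| <= C) -> UltraFilter G ->
  exists x, forall l, dual l -> l (u n) @[n --> G] --> l x.
Proof.
move=> hX uC GU.
have C0 : 0 <= C := le_trans (normr_ge0 _) (uC 0).
have lu l n : dual l -> `|l (u n)| <= C * dual_norm l.
  move=> dl; apply: le_trans (dual_norm_le _ dl) _.
  by rewrite mulrC ler_wpM2r// dual_norm_ge0.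
have cv l : dual l -> exists r : R, l (u n) @[n --> G] --> r.
  move=> dl; pose b := C * dual_norm l.
  apply: (compact_ultra_cvg GU (@segment_compact R (- b) b)).
  by apply: filterE => n /=; rewrite in_itv /= -ler_norml lu.
have cvl l : dual l -> l (u n) @[n --> G] --> lim (l (u n) @[n --> G]).
  by move=> /cv[y ly]; apply/cvg_ex; exists y.
have [|x hx] := hX (fun l => lim (l (u n) @[n --> G])).
  split=> [a l1 l2 d1 d2|].
    apply/cvg_lim => //; apply: cvgD; last exact: cvl.
    by apply: cvgM; [exact: cvg_cst|exact: cvl].
  exists C => l dl.
  have ln : `|l (u n)| @[n --> G] --> `|lim (l (u n) @[n --> G])|.
    by apply: cvg_norm; exact: cvl.
  rewrite -(cvg_lim _ ln)//; apply: limr_le.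
    by apply/cvg_ex; eexists; exact: ln.
  by apply: filterE => n; exact: lu.
by exists x => l dl; rewrite -hx//; exact: cvl.
Qed.

End Dual.

(** * Weak sequential compactness of bounded sequences *)

Section WeakCompactness.
Set Implicit Arguments.
Unset Strict Implicit.
Context {R : realType} {X : normedModType R}.
Implicit Types (u : nat -> X) (l : X -> R) (x w : X) (s t : seq (nat * rat)).

(** Finite lists with rational coefficients form a countable type, so these combinations can be
    enumerated. *)
Definition rat_comb u s : X := \sum_(p <- s) ratr p.2 *: u p.1.

Lemma rat_comb_cat u s t : rat_comb u (s ++ t) = rat_comb u s + rat_comb u t.
Proof. by rewrite /rat_comb big_cat. Qed.

Lemma rat_comb_scale u s (r : rat) :
  rat_comb u [seq (p.1, r * p.2) | p <- s] = ratr r *: rat_comb u s.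
Proof.
rewrite /rat_comb big_map scaler_sumr; apply: eq_bigr => p _ /=.
by rewrite scalerA rmorphM.
Qed.

Lemma rat_comb1 u n (r : rat) : rat_comb u [:: (n, r)] = ratr r *: u n.
Proof. by rewrite /rat_comb big_seq1. Qed.

Definition rat_span_dist u x : R :=
  inf [set `|x - rat_comb u s| | s in [set: seq (nat * rat)]].

Lemma rat_span_dist_has_lbound u x :
  has_lbound [set `|x - rat_comb u s| | s in [set: seq (nat * rat)]].
Proof. by exists 0 => _ [s _ <-]; exact: normr_ge0. Qed.

Lemma rat_span_dist_le u x s : rat_span_dist u x <= `|x - rat_comb u s|.
Proof. by apply: ge_inf; [exact: rat_span_dist_has_lbound|exists s]. Qed.

Lemma sublinear_rat_span_dist u : sublinear (rat_span_dist u).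
Proof.
apply: sublinear_inf.
- by exists [::].
- exact: rat_span_dist_has_lbound.
- move=> s t x y _ _; exists (s ++ t) => //.
  by rewrite rat_comb_cat opprD addrACA ler_normD.
- move=> a e s x a0 e0 _; set c := rat_comb u s.
  have c1 : 0 < `|c| + 1 by rewrite ltr_wpDl.
  (* A rational just above [a] replaces it at a cost of at most [e]; the added 1 keeps the
     denominator positive. *)
  have /rat_in_itvoo[r] : a < a + e / (`|c| + 1).
    by rewrite ltrDl divr_gt0.
  rewrite in_itv /= => /andP[ar ra].
  exists [seq (p.1, r * p.2) | p <- s] => //; rewrite rat_comb_scale -/c.
  have -> : a *: x - ratr r *: c = a *: (x - c) - (ratr r - a) *: c.
    by rewrite scalerBr scalerBl opprB addrA subrK.
  apply: le_trans (ler_normB _ _) _; rewrite !normrZ (ger0_norm a0) lerD2l.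
  rewrite gtr0_norm ?subr_gt0//.
  apply: (@le_trans _ _ (e / (`|c| + 1) * (`|c| + 1))).
    by apply: ler_pM => //; rewrite ?subr_ge0; lra.
  by rewrite divfK// gt_eqF.
Qed.

(** Hahn-Banach for the distance to the rational span gives an [l] equal to that distance at [w].
    Being nonpositive at both [u n] and its opposite, [l] kills every [u n], so the distance is
    0. *)
Lemma rat_comb_approx u w :
  (forall l, dual l -> (forall n, l (u n) = 0) -> l w = 0) ->
  forall e, 0 < e -> exists s, `|w - rat_comb u s| < e.
Proof.
move=> hw e e0.
have [l [sl ld lw]] := hahn_banach w (sublinear_rat_span_dist u).
have dl : dual l.
  apply: dual_of_le_norm => // x; apply: le_trans (ld x) _.
  by have := rat_span_dist_le u x [::]; rewrite /rat_comb big_nil subr0.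
have l0 n : l (u n) = 0.
  have lun (r : rat) : ratr r * l (u n) <= 0.
    rewrite -scalar_funZ// -rat_comb1; apply: le_trans (ld _) _.
    by have := rat_span_dist_le u (rat_comb u [:: (n, r)]) [:: (n, r)];
      rewrite subrr normr0.
  apply/eqP; rewrite eq_le; apply/andP; split.
    by have := lun 1; rewrite rmorph1 mul1r.
  by have := lun (-1); rewrite rmorphN1 mulN1r oppr_le0.
have we : rat_span_dist u w < e by rewrite -lw hw.
have [|_ [s _ <-] wse] := inf_lt _ we; last by exists s.
by exists `|w - rat_comb u [::]|, [::].
Qed.

(* No diagonal extraction: the weak limit x along an ultrafilter is known in
   advance, so k n can be chosen to match x to precision 1/(n+1) against the
   first n+1 members of a countable family of functionals that separates the
   points of the closed span of u.  Every weak ultrafilter limit of the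
   subsequence then coincides with x. *)
Theorem reflexive_weak_seq_compact u (C : R) :
  reflexive_space X -> (forall n, `|u n| <= C) ->
  exists (k : nat -> nat) x,
    (forall n, (n <= k n)%N) /\ weak_cvg (u \o k) x.
Proof.
move=> hX uC.
have [G [GU ooG]] := ultraFilterLemma (eventually_filter : ProperFilter \oo).
have [x Gx] := reflexive_ultra_cvg hX uC GU.
have [L hL] := choice (fun s => exists_norming_functional (rat_comb u s)).
pose LL (j : nat) := L (odflt [::] (unpickle j)).
have LLs s : LL (pickle s) = L s by rewrite /LL pickleK.
have dLL j : dual (LL j) by have [] := hL (odflt [::] (unpickle j)).
(* [G] contains every tail and, for each of the finitely many functionals, the indices where it is
   close to its limit; these sets have a common point. *)
have pick n : exists m, (n <= m)%N /\
    forall j : 'I_n.+1, `|LL j x - LL j (u m)| < n.+1%:R^-1.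
  apply: (@filter_ex _ G); apply: filterI; first exact/ooG/nbhs_infty_ge.
  apply: filter_forall => j.
  have := @cvgr_dist_lt _ _ _ G _ _ _ (Gx _ (dLL j)) (n.+1%:R^-1).
  by apply; rewrite invr_gt0.
have [k hk] := choice pick.
have kn n : (n <= k n)%N := (hk n).1.
exists k, x; split => //.
have Lcvg s : L s (u (k n)) @[n --> \oo] --> L s x.
  apply/cvgrPdist_lt => e e0; near=> n.
  have sn : (pickle s < n.+1)%N by rewrite ltnS; near: n; exact: nbhs_infty_ge.
  rewrite -LLs; apply: lt_trans ((hk n).2 (Ordinal sn)) _; near: n.
  exact: near_infty_natSinv_lt (PosNum e0).
have uniq_lim G' (GU' : UltraFilter G') x' : \oo `<=` G' ->
    (forall l, dual l -> l (u (k n)) @[n --> G'] --> l x') -> x' = x.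
  move=> ooG' Gx'; apply/eqP; rewrite -subr_eq0; apply/eqP; set w := x' - x.
  have lim0 l (F : set_system nat) (FU : UltraFilter F) (v : nat -> X) z :
      (forall n, l (v n) = 0) -> l (v n) @[n --> F] --> l z -> l z = 0.
    move=> l0; under eq_fun do rewrite l0.
    move=> lz; exact: cvg_unique lz (cvg_cst _).
  (* A functional killing every [u n] kills both limits, so [w] lies in the closed span of [u]. *)
  have w0 l : dual l -> (forall n, l (u n) = 0) -> l w = 0.
    move=> dl l0; rewrite (scalar_funB _ _ dl.1).
    have -> := lim0 l G' GU' (u \o k) x' (fun n => l0 (k n)) (Gx' l dl).
    by rewrite (lim0 l G GU u x l0 (Gx l dl)) subr0.
  have [//|wn0] := eqVneq w 0; have {wn0} nw : 0 < `|w| by rewrite normr_gt0.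
  (* Let [y] be the combination within a quarter of [|w|] from [w]. As [L s] kills [w] and norms
     [y], also [|y| <= |y - w|], whence [|w| < |w| / 2]. *)
  have [s ws] := rat_comb_approx w0 (divr_gt0 nw (ltr0n _ 4)).
  have [dl ln ls] := hL s.
  have Lw : L s w = 0.
    rewrite (scalar_funB _ _ dl.1); apply/eqP; rewrite subr_eq0; apply/eqP.
    apply: cvg_unique (Gx' _ dl) _ => //.
    by apply: cvg_trans (Lcvg s); apply: cvg_app.
  have h1 := ln (rat_comb u s - w).
  rewrite (scalar_funB _ _ dl.1) Lw ls subr0 distrC in h1.
  have := ler_normD (w - rat_comb u s) (rat_comb u s); rewrite subrK.
  by move=> h2; exfalso; lra.
move=> l dl; apply: cvg_of_ultra => G' GU' ooG'.
have [x' Gx'] := reflexive_ultra_cvg hX (fun n => uC (k n)) GU'.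
by rewrite -(uniq_lim G' GU' x' ooG' Gx'); exact: Gx'.
Unshelve. all: by end_near. Qed.

End WeakCompactness.

(** * Penalty functions and their exactness *)

Section Penalty.
Set Implicit Arguments.
Unset Strict Implicit.
Context {R : realType}.

Lemma lt_limn_einf_near (g : nat -> \bar R) (a : \bar R) :
  (a < limn_einf g)%E -> \forall n \near \oo, (a < g n)%E.
Proof.
rewrite /limn_einf lteNr => /ereal_inf_lt[_ [A FA <-]] supA.
apply: filterS FA => n An.
rewrite -lteN2; apply: le_lt_trans supA; apply: ereal_sup_ubound.
by exists n.
Qed.

Lemma near_cvge_fin (g : nat -> \bar R) (a : R) :
  (forall e, 0 < e -> \forall n \near \oo, ((a - e)%:E < g n < (a + e)%:E)%E) ->
  g n @[n --> \oo] --> a%:E.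
Proof.
move=> h; apply/fine_cvgP; split.
  apply: filterS (h 1 ltr01) => n /andP[h1 h2].
  by rewrite fin_numE; case: (g n) h1 h2.
apply/cvgrPdist_lt => e e0; apply: filterS (h e e0) => n /andP[] /=.
case: (g n) => //= r; rewrite !lte_fin => h1 h2.
by rewrite ltr_norml; apply/andP; split; lra.
Qed.

Context {X : normedModType R} (M Q : set X) (f phi : X -> \bar R).
Hypotheses (hf : forall x, f x != -oo%E) (hphi : infeasibility_measure M Q phi).
Local Notation fstar := (opt_value (M `&` Q) f).
Local Notation argmin := (argminP M Q f).
Local Notation F := (penalty f phi).
Implicit Types (x y : X) (c : R).

Lemma le_penalty c c' x : c <= c' -> (F c x <= F c' x)%E.
Proof.
move=> cc'; rewrite /penalty leeD2l//; apply: lee_wpmul2r; first exact: hphi.1.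
by rewrite lee_fin.
Qed.

Lemma le_f_penalty c x : 0 <= c -> (f x <= F c x)%E.
Proof. by move=> c0; rewrite /penalty leeDl// mule_ge0// hphi.1. Qed.

Lemma penalty_feasible c x : M x -> Q x -> F c x = f x.
Proof. by move=> Mx Qx; rewrite /penalty (hphi.2 _ Qx).2// mule0 adde0. Qed.

Lemma argmin_value x : argmin x -> f x = fstar.
Proof.
move=> [Ax hx]; apply/eqP; rewrite eq_le; apply/andP; split.
  by apply: le_ereal_inf_tmp => _ [y Ay <-]; exact: hx.
by apply: ereal_inf_lbound; exists x.
Qed.

Lemma argmin_penalty c x : argmin x -> F c x = fstar.
Proof.
by move=> ax; have [[Mx Qx] _] := ax; rewrite penalty_feasible// argmin_value.
Qed.

Lemma penalty_fin c x : 0 < c -> (F c x < +oo)%E ->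
  exists b h : R, [/\ f x = b%:E, phi x = h%:E & 0 <= h].
Proof.
move=> c0; rewrite /penalty; have := hphi.1 x; have := hf x.
case: (f x) => [b| |]//= _; case: (phi x) => [h| |]//= h0.
- by exists b, h; split => //; rewrite -lee_fin.
- by rewrite gt0_muley// lte_fin.
- by rewrite gt0_muley// lte_fin.
Qed.

Lemma globally_exact_of_bound c : argmin !=set0 -> fstar \is a fin_num ->
  0 <= c -> (forall x, Q x -> (fstar <= F c x)%E) -> globally_exact M Q f phi.
Proof.
(* The surplus 1 keeps each [c'] strictly above [c], which forces [phi] to vanish at minimizers. *)
move=> [x0 ax0] fin c0 hc; exists (c + 1); first by rewrite addr_ge0.
move=> c' cc'; have c'0 : 0 < c' by lra.
apply/seteqP; split => [x ax|x [Qx hx]].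
  split; first by case: ax => -[].
  move=> y Qy; rewrite (argmin_penalty _ ax); apply: le_trans (hc y Qy) _.
  by apply: le_penalty; lra.
have [[Mx0 Qx0] _] := ax0.
have Fx : (F c' x <= fstar)%E by rewrite -(argmin_penalty c' ax0); exact: hx.
have Mx : M x.
  apply/(hphi.2 _ Qx).
  have [|b [h [fb ph h0]]] := @penalty_fin c' x c'0.
    by apply: le_lt_trans Fx _; rewrite ltey_eq fin.
  have := le_trans Fx (hc x Qx).
  rewrite /penalty fb ph -!EFinM -!EFinD lee_fin => le.
  by congr EFin; nra.
split => // y [My Qy]; rewrite -(penalty_feasible c' Mx Qx).
by apply: le_trans Fx _; apply: ereal_inf_lbound; exists y.
Qed.

(** The supremum need not be attained; the strict inequality provides an admissible radius above
    [r]. *)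
Lemma exactness_radius_gt x y cs r c :
  (r%:E < exactness_radius Q f phi x cs)%E -> `|x - y| <= r -> Q y ->
  cs <= c -> (F c x <= F c y)%E.
Proof.
move=> /ereal_sup_gt[_ [r' [_ hr'] <-]]; rewrite lte_fin => rr' xy Qy csc.
by apply: hr' => //; split => //; rewrite /closed_ball_ /=; lra.
Qed.

Lemma globally_exact_necessity : argmin !=set0 ->
  globally_exact M Q f phi ->
  (exists2 c0 : R, 0 <= c0 & penalty_sublevel M Q f phi c0 = set0) /\
  uniformly_locally_exact M Q f phi.
Proof.
move=> [x0 ax0] [cs cs0 hcs].
have opt c x y : cs <= c -> argmin x -> Q y -> (F c x <= F c y)%E.
  by move=> csc ax Qy; have := ax; rewrite (hcs c csc) => -[_]; exact.
have lexact x : argmin x -> local_exactness_params Q f phi x cs.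
  move=> ax; split => // c csc; split; first by case: ax => -[].
  by apply: filterE => y; exact: opt.
split.
  exists cs => //; apply/seteqP; split => // x [Qx].
  rewrite -(argmin_penalty cs ax0) ltNge => /negP; apply.
  exact: opt.
split=> [x ax|]; first by exists cs; exact: lexact.
(* Adding 1 makes the bound on the least parameter strict. The radius is arbitrary, since the
   inequality holds on all of [Q]. *)
exists (cs + 1), 1; split => // [|x ax]; first by rewrite ltr_wpDl.
split.
  apply: (@le_lt_trans _ _ cs%:E); last by rewrite lte_fin ltrDl.
  by apply: ereal_inf_lbound; exists cs => //; exact: lexact.
apply: ereal_sup_ubound; exists 1 => //; split => // y [_ Qy] c csc.
by apply: opt => //; lra.
Qed.

Lemma penalty_weak_limit (c v : nat -> _) x :
  fstar \is a fin_num -> Q x ->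
  weakly_seq_lsc_on Q f -> weakly_seq_lsc_on Q phi ->
  (forall n, Q (v n)) -> weak_cvg v x ->
  (forall n : nat, 0 < c n /\ n%:R <= c n) ->
  (forall n, F (c n) (v n) < fstar)%E ->
  f (v n) @[n --> \oo] --> fstar /\ phi (v n) @[n --> \oo] --> 0%E.
Proof.
move=> fin Qx flsc philsc Qv vx hc Fv.
have [fs fsE] : exists fs, fstar = fs%:E by exists (fine fstar); rewrite fineK.
rewrite fsE in Fv *.
have fv n : (f (v n) < fs%:E)%E.
  by apply: le_lt_trans (Fv n); apply: le_f_penalty; apply: ltW; case: (hc n).
have flim a : (a < f x)%E -> \forall n \near \oo, (a < f (v n))%E.
  move=> afx; apply: lt_limn_einf_near; apply: lt_le_trans afx _.
  exact: flsc.
have fxs : (f x <= fs%:E)%E.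
  rewrite leNgt; apply/negP => /flim[n _ /(_ n (leqnn n)) /=].
  by rewrite ltNge (ltW (fv n)).
have [r fxr] : exists r, f x = r%:E.
  by have := hf x; move: fxs; case: (f x) => // r; exists r.
(* Eventually [f (v n) > r - 1], hence [c n * phi (v n) < fs - r + 1]. As [c n >= n], this puts
   [phi (v n)] below [e] once [n > (fs - r + 1) / e]. *)
have phiv e : 0 < e -> \forall n \near \oo, (phi (v n) < e%:E)%E.
  move=> e0.
  have fr : \forall n \near \oo, ((r - 1)%:E < f (v n))%E.
    by apply: flim; rewrite fxr lte_fin; lra.
  near=> n; have [c0 nc] := hc n.
  have [|b [h [fb ph h0]]] := @penalty_fin (c n) (v n) c0.
    by apply: lt_trans (Fv n) _; rewrite ltry.
  have rb : ((r - 1)%:E < f (v n))%E by near: n; exact: fr.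
  have ne : (fs - r + 1) / e < n%:R by near: n; exact: nbhs_infty_gtr.
  have := Fv n; rewrite /penalty fb ph -EFinM -EFinD !lte_fin => lt.
  rewrite fb lte_fin in rb; rewrite ltr_pdivrMr// in ne.
  rewrite ltNge; apply/negP => eh.
  have : n%:R * e <= c n * h by apply: ler_pM => //; exact: ltW.
  by lra.
have phi0 : phi x = 0%E.
  apply/eqP; rewrite eq_le hphi.1 andbT leNgt; apply/negP => phi0.
  have [e e0 ephi] : exists2 e : R, 0 < e & (e%:E < phi x)%E.
    move: phi0; case: (phi x) => [h| |]//; last by exists 1; rewrite ?ltry.
    by rewrite lte_fin => h0; exists (h / 2); rewrite ?lte_fin; lra.
  have ev : \forall n \near \oo, (e%:E < phi (v n))%E.
    apply: lt_limn_einf_near; apply: lt_le_trans ephi _; exact: philsc.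
  have [n []] := filter_ex (filterI ev (phiv e e0)).
  by move=> /lt_trans h /h; rewrite ltxx.
have Mx : M x by apply/(hphi.2 _ Qx).
(* Feasibility of [x] turns semicontinuity of [f] into the lower half of the convergence to [fs];
   [fv] is the upper half. *)
have fsx : (fs%:E <= f x)%E.
  by rewrite -fsE; apply: ereal_inf_lbound; exists x.
split.
  apply: near_cvge_fin => e e0.
  have : ((fs - e)%:E < f x)%E.
    by apply: lt_le_trans fsx; rewrite lte_fin; lra.
  move=> /flim; apply: filterS => n -> /=.
  by apply: lt_trans (fv n) _; rewrite lte_fin; lra.
apply: near_cvge_fin => e e0; apply: filterS (phiv e e0) => n.
rewrite !add0r => ->; rewrite andbT; apply: lt_le_trans (hphi.1 _).
by rewrite lte_fin; lra.
Unshelve. all: by end_near. Qed.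

End Penalty.

Theorem theorem4 (R : realType) (X : completeNormedModType R)
  (M Q : set X) (f phi : X -> \bar R)
  (hX : reflexive_space X)
  (hM : M !=set0) (hQ : Q !=set0) (hOmega : M `&` Q !=set0)
  (hf : forall x, f x != -oo%E)
  (hfstar : opt_value (M `&` Q) f \is a fin_num)
  (hphi : infeasibility_measure M Q phi)
  (hQclosed : weakly_seq_closed Q)
  (hflsc : weakly_seq_lsc_on Q f)
  (hphilsc : weakly_seq_lsc_on Q phi)
  (hLP : weakly_LP_well_posed M Q f phi) :
  globally_exact M Q f phi <->
  ((exists2 c0 : R, 0 <= c0 &
      bounded_set (penalty_sublevel M Q f phi c0) \/
      penalty_sublevel M Q f phi c0 = set0) /\
   uniformly_locally_exact M Q f phi).
Proof.
have [argmin0 LP] := hLP; split.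
  move=> /(globally_exact_necessity hphi argmin0)[[c0 c00 S0] ule].
  by split => //; exists c0 => //; right.
move=> [[c0 c00 hS] [_ [cs [rs [cs0 rs0 ule]]]]].
apply: contrapT => nexact.
(* Large enough for three purposes: divergence, staying in the sublevel set of [c0], and local
   exactness from [cs] on. *)
pose c n := n%:R + c0 + cs.
have cge n : [/\ 0 < c n, n%:R <= c n, c0 <= c n & cs <= c n].
  by have := ler0n R n; rewrite /c; split; lra.
have /choice[u hu] n : exists x, Q x /\
    (penalty f phi (c n) x < opt_value (M `&` Q) f)%E.
  apply: contrapT => nx; apply: nexact.
  have [cn0 _ _ _] := cge n.
  apply: (globally_exact_of_bound hf hphi argmin0 hfstar (ltW cn0)) => x Qx.
  by rewrite leNgt; apply/negP => lt; apply: nx; exists x.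
have uS n : penalty_sublevel M Q f phi c0 (u n).
  have [Qu Fu] := hu n; split => //; apply: le_lt_trans Fu.
  by apply: (le_penalty f hphi); have [] := cge n.
case: hS => [bS|S0]; last by have := uS 0%N; rewrite S0.
have [C uC] : exists C, forall n, `|u n| <= C.
  (* [bounded_set] only provides bounds strictly above [C]. *)
  have [C [_ hC]] := bS; exists (C + 1) => n.
  by apply: (hC (C + 1)); [rewrite ltrDl|exact: uS].
have [k [x [kn vx]]] := reflexive_weak_seq_compact hX uC.
have Qv n : Q ((u \o k) n) by have [] := hu (k n).
have [||fv phiv] := @penalty_weak_limit _ _ M Q f phi hf hphi (c \o k) _ x
  hfstar (hQclosed _ _ Qv vx) hflsc hphilsc Qv vx.
- move=> n; have [ck0 kck _ _] := cge (k n); split => //.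
  by apply: le_trans kck; rewrite ler_nat.
- by move=> n; have [] := hu (k n).
(* Half of [rs] lies strictly below the exactness radius of every minimizer, and a distance below it
   yields an actual minimizer [y] that close. *)
have /cvgr_lt/(_ (rs / 2)) := LP _ fv phiv.
rewrite divr_gt0// => /(_ isT)[n _ /(_ n (leqnn n)) /=] dn.
have [|_ [y ay <-] yn] := inf_lt _ dn.
  by have [y ay] := argmin0; exists `|u (k n) - y|, y.
have [_ rad] := ule y ay.
have [Qn Fn] := hu (k n); have [_ _ _ csk] := cge (k n).
suff : (penalty f phi (c (k n)) y <= penalty f phi (c (k n)) (u (k n)))%E.
  by rewrite (argmin_penalty hphi _ ay) leNgt Fn.
apply: (@exactness_radius_gt _ _ Q f phi y _ cs (rs / 2)) => //.
  by apply: lt_le_trans rad; rewrite lte_fin; lra.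
by rewrite distrC ltW.
Qed.
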